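(* Let $K:\mathcal X\to\mathcal Y$ be a compact linear operator with infinite dimensional range, let $r\ge0$, and let $R_{\alpha,r}$ be the corresponding family of weighted Tikhonov regularization operators. Let $y$ be attainable, $x^\dagger=K^\dagger y$, and let $\alpha=\alpha(\delta,y^\delta)>0$ be any parameter choice rule; write $x_{\alpha,r}^\delta=R_{\alpha(\delta,y^\delta),r}\,y^\delta$. If $$\sup\big\{\|x_{\alpha,r}^\delta-x^\dagger\|:\ \|Q(y-y^\delta)\|\le\delta\big\}=o\big(\delta^{\frac{r+1}{r+2}}\big)\qquad(\delta\to0),$$ where $Q$ is the orthogonal projector onto $\overline{R(K)}$, then $x^\dagger=0$.
   Context: $\mathcal X,\mathcal Y$ are Hilbert spaces; $R(K)$ is the range of $K$; $y$ attainable means $y\in R(K)$. $(\sigma_m;v_m,u_m)$ is the singular value expansion of $K$: $\sigma_1\ge\sigma_2\ge\dots>0$, $\{v_m\}$, $\{u_m\}$ orthonormal and complete in $(\ker K)^\perp$ and $\overline{R(K)}$, $Kv_m=\sigma_mu_m$, $K^*u_m=\sigma_mv_m$. $K^\dagger$ is the Moore-Penrose generalized inverse, $K^\dagger y=\sum_m\sigma_m^{-1}\langle y,u_m\rangle v_m$. Weighted Tikhonov method: $R_{\alpha,r}y=\sum_mF_{\alpha,r}(\sigma_m)\sigma_m^{-1}\langle y,u_m\rangle v_m$ with $F_{\alpha,r}(\sigma)=\frac{\sigma^{r+1}}{\sigma^{r+1}+\alpha}$, $\alpha>0$, $r\ge0$. A parameter choice rule is a map $(\delta,y^\delta)\mapsto\alpha(\delta,y^\delta)\in(0,\infty)$;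 the supremum is over all $y^\delta\in\mathcal Y$ with the stated property. *)

(* Defs.v *)
(* Written in the MathComp / MathComp-Analysis world. *)
From HB Require Import structures.
From mathcomp Require Export all_boot all_order all_algebra.
From mathcomp Require Export all_classical all_reals all_analysis.
From mathcomp Require Import complex.

Set Implicit Arguments.
Unset Strict Implicit.
Unset Printing Implicit Defensive.

Export Order.TTheory GRing.Theory Num.Theory.
Export numFieldNormedType.Exports.

Local Open Scope classical_set_scope.
Local Open Scope ring_scope.

(* Hilbert spaces may be real or complex: everything below is parametrized by
   the kind of scalars.  The kind is shared by all spaces in a statement.     *)
Variant scalar_kind := RealScalars | ComplexScalars.

Definition scalar (R : realType) (k : scalar_kind) : numFieldType :=
  match k with RealScalars => R | ComplexScalars => R[i]%C end.

Definition scalar_conj (R : realType) (k : scalar_kind) :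
    scalar R k -> scalar R k :=
  match k with RealScalars => idfun | ComplexScalars => @conjc R end.

Definition of_real (R : realType) (k : scalar_kind) : R -> scalar R k :=
  match k with
  | RealScalars => idfun
  | ComplexScalars => fun x => (x%:C)%C
  end.

Definition re_part (R : realType) (k : scalar_kind) : scalar R k -> R :=
  match k with RealScalars => idfun | ComplexScalars => @complex.Re R end.

(* A complete normed space is a Hilbert space when equipped with an inner
   product inducing its norm.  As in {dot _ for _}, inner products are linear
   in the first argument and conjugate-linear in the second one.              *)
Record inner_product (R : realType) (k : scalar_kind)
    (X : completeNormedModType (scalar R k)) := InnerProduct {
  inner :> {dot X for @scalar_conj R k} ;
  _ : forall x : X, `|x| ^+ 2 = inner x x }.

Section HilbertSpace.
Variables (R : realType) (k : scalar_kind).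
Variables (X : completeNormedModType (scalar R k)) (dX : inner_product X).

(* The library norm takes its values in the scalar field; this is the same
   norm, as a real number.                                                    *)
Definition rnorm (x : X) : R := re_part `|x|.

Definition orthocompl (A : set X) : set X :=
  [set x | forall a, A a -> dX x a = 0].

Definition lin_span (I : finType) (w : I -> X) : set X :=
  [set x | exists c : I -> scalar R k, x = \sum_i c i *: w i].

Definition lin_span_seq (w : nat -> X) : set X :=
  \bigcup_n lin_span (fun i : 'I_n => w i).

Definition orthonormal_seq (w : nat -> X) : Prop :=
  forall m n, dX (w m) (w n) = (m == n)%:R.

(* "w is complete in A", for a closed subspace A *)
Definition complete_in (w : nat -> X) (A : set X) : Prop :=
  closure (lin_span_seq w) = A.

(* The orthogonal projector onto A.  The element selected by xget exists and
   is unique when A is a closed subspace.                                     *)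
Definition orthoproj (A : set X) (x : X) : X :=
  xget 0 [set p | A p /\ orthocompl A (x - p)].

End HilbertSpace.

Section Operators.
Variables (R : realType) (k : scalar_kind).
Variables (X Y : completeNormedModType (scalar R k)).
Variables (dX : inner_product X) (dY : inner_product Y).
Variable K : {linear X -> Y}.

Definition ker : set X := K @^-1` [set 0].

Definition compact_operator : Prop :=
  forall B : set X, bounded_set B -> precompact (K @` B).

Definition infinite_dim_range : Prop :=
  ~ exists n (w : 'I_n -> Y), range K `<=` lin_span w.

(* K^* y is the (unique) Riesz representative of x |-> <K x, y>. *)
Definition adjoint (y : Y) : X :=
  xget 0 [set z | forall x, dY (K x) y = dX x z].

Record singular_value_expansion (sigma : nat -> R)
    (v : nat -> X) (u : nat -> Y) : Prop := SingularValueExpansion {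
  sve_nonincreasing : forall m, sigma m.+1 <= sigma m ;
  sve_gt0 : forall m, 0 < sigma m ;
  sve_orthonormalv : orthonormal_seq dX v ;
  sve_orthonormalu : orthonormal_seq dY u ;
  sve_completev : complete_in v (orthocompl dX ker) ;
  sve_completeu : complete_in u (closure (range K)) ;
  sve_K : forall m, K (v m) = of_real k (sigma m) *: u m ;
  sve_adjoint : forall m, adjoint (u m) = of_real k (sigma m) *: v m }.

(* The Moore-Penrose inverse is the linear extension, vanishing on R(K)^perp,
   of the inverse of K restricted to (ker K)^perp.  On R(K) + R(K)^perp this
   determines a unique value; outside that domain (where K^dagger is
   undefined) the value is the junk 0.                                        *)
Definition moore_penrose (y : Y) : X :=
  xget 0 [set x | orthocompl dX ker x /\ orthocompl dY (range K) (y - K x)].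

End Operators.

Section WeightedTikhonov.
Variables (R : realType) (k : scalar_kind).
Variables (X Y : completeNormedModType (scalar R k)).
Variable dY : inner_product Y.
Variables (sigma : nat -> R) (v : nat -> X) (u : nat -> Y).

Definition weighted_filter (alpha r s : R) : R :=
  s `^ (r + 1) / (s `^ (r + 1) + alpha).

Definition weighted_tikhonov (alpha r : R) (y : Y) : X :=
  limn (series (fun m =>
    (of_real k (weighted_filter alpha r (sigma m) * (sigma m)^-1)
       * dY y (u m)) *: v m)).

End WeightedTikhonov.

Section WorstCaseError.
Variables (R : realType) (k : scalar_kind).
Variables (X Y : completeNormedModType (scalar R k)).
Variable dY : inner_product Y.
Variable K : {linear X -> Y}.
Variables (sigma : nat -> R) (v : nat -> X) (u : nat -> Y).

(* The supremum is taken in the extended reals, hence may be +oo. *)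
Definition worst_case_error (r : R) (alpha : R -> Y -> R) (y : Y) (xdag : X)
    (delta : R) : \bar R :=
  ereal_sup [set (rnorm (weighted_tikhonov dY sigma v u (alpha delta yd) r yd
                         - xdag))%:E
            | yd in [set yd | rnorm (orthoproj dY (closure (range K)) (y - yd))
                              <= delta]].

End WorstCaseError.

(* Main.v *)
Require Import Defs.
From mathcomp Require Import complex.
From mathcomp Require Import ring lra.

Set Implicit Arguments.
Unset Strict Implicit.
Unset Printing Implicit Defensive.

Local Open Scope classical_set_scope.
Local Open Scope ring_scope.

(** Write x for xdag = K^dagger y, x_j = <x, v_j> and s_j = sigma_j ^ (r + 1).
    On the singular system the method multiplies the j-th coefficient by
    F_j = s_j / (s_j + alpha).

    The rule must cope with noise concentrated on a single singular vector u_m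
    at the noise level where that mode sits exactly on the edge of the
    attainable rate: take delta = sigma_m ^ (r + 2), so that
    delta ^ ((r + 1) / (r + 2)) = s_m, and let the data be K z with
    z = x - s_m c v_m, where the unimodular scalar c is the phase of x_m.
    Whatever alpha the rule returns for this datum, two coefficients of the
    reconstruction error are explicit:
    - in the direction v_m, the regularization error -(1 - F_m) x_m and the
      propagated noise -F_m s_m c have the same phase, so they cannot cancel
      and the error is at least F_m s_m;
    - in every other direction v_j the data are exact and the error is
      (1 - F_j) |x_j| = alpha / (s_j + alpha) |x_j|.
    If the worst-case error is at most eps s_m with eps <= 1/2, the first bound
    forces alpha >= s_m: the noise has to be damped.  The second one then gives
    |x_j| <= 2 eps s_j as soon as s_m <= s_j ([filter_tradeoff]).

    Because K is compact, sigma_m -> 0 ([sigma_lt]), so the noise levels above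
    accumulate at 0 and the o-hypothesis supplies such an m > j for every eps.
    Hence all x_j vanish, and x = 0 because the v_j are complete in
    (ker K)^perp.

    Since the reconstruction is a limit of partial sums, its coefficients are
    known only once the series is shown to converge; this is Bessel's
    inequality together with completeness of the space
    ([cvg_series_orthonormal], [inner_lim_orthonormal]). *)

(** * Real numbers inside the scalar field *)

Section Scalars.
Variables (R : realType) (k : scalar_kind).
Implicit Types (a b : scalar R k) (x y : R).

Lemma of_realD : {morph @of_real R k : x y / x + y}.
Proof. by case: k => //= x y; rewrite rmorphD. Qed.

Lemma of_realM : {morph @of_real R k : x y / x * y}.
Proof. by case: k => //= x y; rewrite rmorphM. Qed.

Lemma of_realN : {morph @of_real R k : x / - x}.
Proof. by case: k => //= x; rewrite rmorphN. Qed.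

Lemma of_real1 : of_real k 1 = 1 :> scalar R k.
Proof. by case: k. Qed.

Lemma of_real0 : of_real k 0 = 0 :> scalar R k.
Proof. by case: k. Qed.

Lemma scalar_conj0 : scalar_conj 0 = 0 :> scalar R k.
Proof. by case: k => //=; exact: conjc0. Qed.

Lemma scalar_conj_of_real x : scalar_conj (of_real k x) = of_real k x.
Proof. by case: k => //=; exact: conjc_real. Qed.

Lemma of_real_le x y : (of_real k x <= of_real k y) = (x <= y).
Proof. by case: k => //=; rewrite lecR. Qed.

Lemma of_real_lt x y : (of_real k x < of_real k y) = (x < y).
Proof. by case: k => //=; rewrite ltcR. Qed.

Lemma of_real_ge0 x : 0 <= x -> 0 <= of_real k x.
Proof. by move=> x0; rewrite -of_real0 of_real_le. Qed.

Lemma norm_of_real x : 0 <= x -> `|of_real k x| = of_real k x.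
Proof. by move=> x0; rewrite ger0_norm ?of_real_ge0. Qed.

Lemma re_partK a : 0 <= a -> of_real k (re_part a) = a.
Proof.
case: k a => //= -[x y]; rewrite lecE /= => /andP[/eqP -> _]; by [].
Qed.

Lemma rnormK (X : completeNormedModType (scalar R k)) (z : X) :
  of_real k (rnorm z) = `|z|.
Proof. by rewrite re_partK. Qed.

End Scalars.

(** * Inner products and orthonormal series *)

Section Inner.
Variables (R : realType) (k : scalar_kind).
Variables (X : completeNormedModType (scalar R k)) (dX : inner_product X).
Implicit Types (x y z : X) (a : scalar R k).

Lemma innerDl x y z : dX (x + y) z = dX x z + dX y z.
Proof. by rewrite linearDl. Qed.

Lemma innerBl x y z : dX (x - y) z = dX x z - dX y z.
Proof. by rewrite linearBl. Qed.

Lemma innerZl a x z : dX (a *: x) z = a * dX x z.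
Proof. by rewrite linearZl_LR. Qed.

Lemma inner0l z : dX 0 z = 0.
Proof. by rewrite linear0l. Qed.

Lemma innerDr x y z : dX x (y + z) = dX x y + dX x z.
Proof. by rewrite linearDr. Qed.

Lemma innerBr x y z : dX x (y - z) = dX x y - dX x z.
Proof. by rewrite linearBr. Qed.

Lemma innerZr a x z : dX x (a *: z) = scalar_conj a * dX x z.
Proof. by rewrite linearZr_LR. Qed.

Lemma innerC x y : dX x y = scalar_conj (dX y x).
Proof. by rewrite {1}(hermitian_subproof (s := inner dX)) expr0 mul1r. Qed.

Lemma inner_eq0C x y : dX x y = 0 -> dX y x = 0.
Proof. by move=> h; rewrite innerC h scalar_conj0. Qed.

Lemma sqr_norm_inner x : `|x| ^+ 2 = dX x x.
Proof. by case: dX => ? /=. Qed.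

Lemma norm_unit x : dX x x = 1 -> `|x| = 1.
Proof.
by rewrite -sqr_norm_inner => /eqP; rewrite sqrp_eq1 // => /eqP.
Qed.

Lemma sqr_normD_orth x y : dX x y = 0 -> `|x + y| ^+ 2 = `|x| ^+ 2 + `|y| ^+ 2.
Proof.
move=> xy0; have yx0 := inner_eq0C xy0.
by rewrite !sqr_norm_inner innerDl !innerDr xy0 yx0 addr0 add0r.
Qed.

Lemma inner_self_eq0 x : dX x x = 0 -> x = 0.
Proof. by rewrite -sqr_norm_inner => /eqP; rewrite sqrf_eq0 normr_eq0 => /eqP. Qed.

Lemma inner_suml (I : Type) (s : seq I) (P : pred I) (F : I -> X) z :
  dX (\sum_(i <- s | P i) F i) z = \sum_(i <- s | P i) dX (F i) z.
Proof. exact: (linear_sumlz (inner dX)). Qed.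

Section OrthonormalSequence.
Variable w : nat -> X.
Hypothesis ow : orthonormal_seq dX w.

Lemma sqr_norm_sum (c : nat -> scalar R k) m n :
  `|\sum_(m <= i < n) c i *: w i| ^+ 2 = \sum_(m <= i < n) `|c i| ^+ 2.
Proof.
have [nm|/ltnW mn] := leqP n m; first by rewrite !big_geq // normr0 expr0n.
elim: n mn => [|n IH].
  by rewrite leqn0 => /eqP ->; rewrite !big_geq // normr0 expr0n.
rewrite leq_eqVlt => /orP[/eqP -> |]; first by rewrite !big_geq // normr0 expr0n.
rewrite ltnS => mn; rewrite !big_nat_recr //= sqr_normD_orth ?IH //.
  by rewrite normrZ norm_unit ?mulr1 // ow eqxx.
rewrite innerZr inner_suml big_nat big1 ?mulr0 // => i /andP[_ lt_in].
by rewrite innerZl ow ltn_eqF // mulr0.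
Qed.

Lemma inner_sum_orthonormal (c : nat -> scalar R k) n j : (j < n)%N ->
  dX (\sum_(0 <= i < n) c i *: w i) (w j) = c j.
Proof.
move=> jn; rewrite inner_suml (bigD1_seq j) ?mem_index_iota ?iota_uniq //=.
rewrite innerZl ow eqxx mulr1 big1 ?addr0 // => i ij.
by rewrite innerZl ow (negPf ij) mulr0.
Qed.

(** The orthogonal projection of [x] on the span of the first [n] vectors has the
    left-hand side as its squared norm. *)
Lemma bessel x n : \sum_(0 <= i < n) `|dX x (w i)| ^+ 2 <= `|x| ^+ 2.
Proof.
set p := \sum_(0 <= i < n) dX x (w i) *: w i.
have -> : \sum_(0 <= i < n) `|dX x (w i)| ^+ 2 = `|p| ^+ 2 by rewrite sqr_norm_sum.
suff o : dX p (x - p) = 0.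
  by rewrite -[x in leRHS](subrK p) addrC sqr_normD_orth // lerDl exprn_ge0.
rewrite inner_suml big_nat big1 // => i /andP[_ ni].
rewrite innerZl (@inner_eq0C (x - p)) ?mulr0 //.
by rewrite innerBl inner_sum_orthonormal // subrr.
Qed.

Lemma norm_coef_le x j : `|dX x (w j)| <= `|x|.
Proof.
rewrite -ler_sqr ?nnegrE //; apply: le_trans (bessel x j.+1).
by rewrite big_nat_recr //= lerDr sumr_ge0 // => i _; rewrite exprn_ge0.
Qed.

(** The norm of a block of the series is the square root of the corresponding
    block of the real series of the [`|c i| ^+ 2], so one series is Cauchy as
    soon as the other is. *)
Lemma cvg_series_orthonormal (c : nat -> scalar R k) (M : scalar R k) :
  (forall n, \sum_(0 <= i < n) `|c i| ^+ 2 <= M) ->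
  cvgn (series (fun i => c i *: w i)).
Proof.
move=> cM.
pose t i := re_part (`|c i| ^+ 2).
have tE i : of_real k (t i) = `|c i| ^+ 2 by rewrite re_partK ?exprn_ge0.
have t0 i : 0 <= t i by rewrite -(of_real_le k) of_real0 tE exprn_ge0.
have tsum m n : of_real k (\sum_(m <= i < n) t i) = \sum_(m <= i < n) `|c i| ^+ 2.
  by rewrite (big_morph _ (@of_realD R k) (of_real0 _ _)); apply: eq_bigr.
have M0 : 0 <= M by apply: le_trans (cM 0); rewrite big_geq.
have : cvgn (series t).
  apply: nondecreasing_is_cvgn.
    by apply/nondecreasing_seqP => n; rewrite seriesEnat /= big_nat_recr //= lerDl.
  exists (re_part M) => _ [n _ <-].
  by rewrite -(of_real_le k) re_partK // seriesEnat /= tsum.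
move=> /cauchy_cvgP /cauchy_seriesP ct.
apply/cauchy_cvgP/cauchy_seriesP => e e0.
have re0 : 0 < re_part e by rewrite -(of_real_lt k) of_real0 re_partK ?ltW.
have := ct _ (exprn_gt0 2 re0).
apply: filterS => -[m n] /= h.
rewrite -ltr_sqr ?nnegrE ?(ltW e0) // sqr_norm_sum.
rewrite -tsum -[e]re_partK ?(ltW e0) // expr2 -of_realM of_real_lt -expr2.
by move: h; rewrite ger0_norm ?sumr_ge0.
Qed.

(** Partial sums beyond rank [j] have [c j] as their [j]-th coefficient, and
    taking a coefficient is 1-Lipschitz. *)
Lemma inner_lim_orthonormal (c : nat -> scalar R k) j :
  cvgn (series (fun i => c i *: w i)) ->
  dX (limn (series (fun i => c i *: w i))) (w j) = c j.
Proof.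
move=> cc; set L := limn _.
apply/eqP; rewrite -subr_eq0; apply: contraT; rewrite -normr_gt0 => e0.
have [N _ hN] : \forall n \near \oo,
    `|L - series (fun i => c i *: w i) n| < `|dX L (w j) - c j|.
  exact: (cvgrPdist_lt _ _).1 cc _ e0.
have := hN (maxn N j.+1) (leq_maxl _ _); rewrite /= seriesEnat /=.
set S := \sum_(_ <= _ < _) _ => LS.
have Sj : dX S (w j) = c j by rewrite inner_sum_orthonormal // leq_maxr.
by have := le_lt_trans (norm_coef_le (L - S) j) LS; rewrite innerBl Sj ltxx.
Qed.

End OrthonormalSequence.
End Inner.

(** * The weighted Tikhonov filter *)

Lemma weighted_filter_ge0 (R : realType) (alpha r s : R) :
  0 < alpha -> 0 <= weighted_filter alpha r s.
Proof. by move=> a0; rewrite divr_ge0 ?addr_ge0 ?powR_ge0 ?ltW. Qed.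

Lemma weighted_filter_le1 (R : realType) (alpha r s : R) :
  0 < alpha -> weighted_filter alpha r s <= 1.
Proof.
by move=> a0; rewrite ler_pdivrMr ?mul1r ?lerDl ?ltW // ltr_wpDl ?powR_ge0.
Qed.

(** [a] plays the regularization parameter: suppressing the noise in mode [m]
    requires [sm <= a], and such an [a] damps the signal [t] in mode [j]. *)
Lemma filter_tradeoff (R : realFieldType) (sj sm a eps t : R) :
  0 < sm -> sm <= sj -> 0 < a -> 0 < eps -> eps <= 1 / 2 -> 0 <= t ->
  sm / (sm + a) * sm <= eps * sm -> a / (sj + a) * t <= eps * sm ->
  t <= 2 * eps * sj.
Proof.
move=> sm0 smj a0 e0 e1 t0.
rewrite ler_pM2r // ler_pdivrMr ?addr_gt0 // => h1.
have sj0 := lt_le_trans sm0 smj.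
rewrite mulrAC ler_pdivrMr ?addr_gt0 // => h2.
have sa : sm <= a by nra.
rewrite -(ler_pM2l a0); apply: le_trans h2 _.
have -> : a * (2 * eps * sj) = eps * (a * sj + sj * a) by ring.
by rewrite -mulrA ler_pM2l // mulrDr lerD // ler_pM2r.
Qed.

(** * Singular systems of compact operators *)

Section OperatorTheory.
Variables (R : realType) (k : scalar_kind).
Implicit Types X Y : completeNormedModType (scalar R k).

Lemma orthoproj_id X (dX : inner_product X) (A : set X) x :
  A x -> orthoproj dX A x = x.
Proof.
move=> Ax; apply: xget_unique => [|p [Ap xp]].
  by split=> // a _; rewrite subrr inner0l.
apply/esym/eqP; rewrite -subr_eq0; apply/eqP/(@inner_self_eq0 _ _ _ dX).
by rewrite innerBr (xp _ Ax) (xp _ Ap) subrr.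
Qed.

(** A vector [x] orthogonal to the span stays, by Pythagoras, at distance at
    least [`|x|] from it, and it lies in its closure. *)
Lemma complete_eq0 X (dX : inner_product X) (w : nat -> X) (A : set X) x :
  complete_in w A -> A x -> (forall j, dX x (w j) = 0) -> x = 0.
Proof.
move=> <- clx x0; apply/eqP; apply: contraT => xN0.
have x0' : 0 < `|x| by rewrite normr_gt0.
have [a [/= [n _ [c aE]] xa]] := clx _ (nbhsx_ballx x `|x| x0').
have a0 : dX x (- a) = 0.
  rewrite -[- a]add0r innerBr (inner_eq0C (inner0l dX x)) sub0r aE.
  apply/eqP; rewrite oppr_eq0; apply/eqP/inner_eq0C.
  rewrite inner_suml big1 // => i _.
  by rewrite innerZl (inner_eq0C (x0 i)) mulr0.
move: xa; rewrite -ball_normE /ball_ /= -ltr_sqr ?nnegrE // (sqr_normD_orth a0).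
by rewrite gtrDl le_gtF ?exprn_ge0.
Qed.

Variables (X Y : completeNormedModType (scalar R k)).
Variables (dX : inner_product X) (dY : inner_product Y) (K : {linear X -> Y}).

(** A nonzero value of [moore_penrose] cannot be its default value, so it has
    the characteristic properties; this spares the proof that the generalized
    inverse is defined at [y]. *)
Lemma moore_penroseP y : range K y -> moore_penrose dX dY K y <> 0 ->
  orthocompl dX (ker K) (moore_penrose dX dY K y) /\
  K (moore_penrose dX dY K y) = y.
Proof.
move=> [x _ <-]; rewrite /moore_penrose.
case: xgetP => [z _ [kz rz] _|_ /(_ erefl)//]; split=> //.
apply/esym/eqP; rewrite -subr_eq0; apply/eqP/(@inner_self_eq0 _ _ _ dY).
have Kxz : range K (K x - K z) by exists (x - z) => //; rewrite linearB.
exact: rz Kxz.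
Qed.

Variables (sigma : nat -> R) (v : nat -> X) (u : nat -> Y).
Hypothesis sveK : singular_value_expansion dX dY K sigma v u.

(** Since [sigma m *: v m] is nonzero, the chosen adjoint value is not the
    default one and represents [x |-> dY (K x) (u m)]. *)
Lemma inner_K_sve x m : dY (K x) (u m) = of_real k (sigma m) * dX x (v m).
Proof.
have := sve_adjoint sveK m; rewrite /adjoint.
case: xgetP => [z _ /(_ x) -> -> | _ /eqP].
  by rewrite innerZr scalar_conj_of_real.
rewrite eq_sym scaler_eq0 => /orP[/eqP s0|/eqP v0].
  by have := sve_gt0 sveK m; rewrite -(of_real_lt k) s0 of_real0 ltxx.
have /eqP := sve_orthonormalv sveK m m.
by rewrite v0 inner0l eqxx eq_sym oner_eq0.
Qed.

Lemma le_sigma m n : (m <= n)%N -> sigma n <= sigma m.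
Proof. by move=> mn; have /nonincreasing_seqP := sve_nonincreasing sveK; apply. Qed.

(** Otherwise the images [K (v m) = sigma m *: u m] of the unit vectors [v m]
    would be uniformly separated, being orthogonal and of norm at least [e],
    and could not have a cluster point. *)
Lemma sigma_lt e : compact_operator K -> 0 < e ->
  exists N, forall m, (N <= m)%N -> sigma m < e.
Proof.
move=> cK e0.
suff [N sN] : exists N, sigma N < e.
  by exists N => m Nm; apply: le_lt_trans sN; apply: le_sigma.
apply: contrapT => nex.
have se m : e <= sigma m by rewrite leNgt; apply/negP => h; apply: nex; exists m.
have bv : bounded_set (range v).
  exists 1; split => // M M1 _ [m _ <-].
  by rewrite /= (norm_unit (dX := dX)) ?ltW // (sve_orthonormalv sveK) eqxx.
have cl : compact (closure (K @` range v)) by rewrite -precompactE; exact: cK.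
have [p [_ pcl]] : closure (K @` range v) `&` cluster ((K \o v) @ \oo) !=set0.
  apply: cl; exists 0%N => // n _; apply: subset_closure.
  by exists (v n) => //; exists n.
have pnear N : exists2 n, (N <= n)%N & `|p - K (v n)| < of_real k (e / 2).
  have [||_ [[n /= Nn <-]]] :=
    pcl [set K (v n) | n in [set n | (N <= n)%N]] (ball p (of_real k (e / 2))).
  - by exists N => // n /= Nn; exists n.
  - by apply: nbhsx_ballx; rewrite -(of_real0 R k) of_real_lt divr_gt0.
  by rewrite -ball_normE => h; exists n.
have [m _ pm] := pnear 0%N; have [n mn pn] := pnear m.+1.
have : `|K (v m) - K (v n)| < of_real k e.
  rewrite (splitr e) of_realD -(subrK p (K (v m))) -addrA.
  apply: le_lt_trans (ler_normD _ _) _; apply: ltrD => //.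
  by rewrite distrC.
rewrite -ltr_sqr ?nnegrE // ?(le_trans _ (ltW pm)) //; last first.
  by rewrite -(of_real0 R k) of_real_le ltW.
rewrite !(sve_K sveK) (sqr_normD_orth (dX := dY)); last first.
  rewrite -[- _]add0r innerBr (inner_eq0C (inner0l dY _)) innerZl innerZr.
  by rewrite (sve_orthonormalu sveK) ltn_eqF // !mulr0 subrr.
rewrite normrZ norm_of_real ?(ltW (sve_gt0 sveK _)) //.
rewrite (norm_unit (dX := dY) (x := u m)) ?(sve_orthonormalu sveK) ?eqxx // mulr1.
rewrite le_gtF // ler_wpDr ?exprn_ge0 // ler_sqr ?nnegrE ?of_real_le //.
  by rewrite of_real_ge0 // ltW.
by rewrite of_real_ge0 // ltW // (sve_gt0 sveK).
Qed.

Lemma inner_weighted_tikhonov alpha r z j : 0 < alpha ->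
  dX (weighted_tikhonov dY sigma v u alpha r (K z)) (v j) =
  of_real k (weighted_filter alpha r (sigma j)) * dX z (v j).
Proof.
move=> a0.
pose c i := of_real k (weighted_filter alpha r (sigma i)) * dX z (v i).
have -> : weighted_tikhonov dY sigma v u alpha r (K z) =
    limn (series (fun i => c i *: v i)).
  rewrite /weighted_tikhonov; congr (limn (series _)); apply/funext => i.
  rewrite inner_K_sve mulrA -of_realM divfK //.
  by rewrite gt_eqF // (sve_gt0 sveK).
apply: (inner_lim_orthonormal (sve_orthonormalv sveK)).
apply: (cvg_series_orthonormal (sve_orthonormalv sveK) (M := `|z| ^+ 2)) => n.
apply: le_trans (bessel (sve_orthonormalv sveK) z n); apply: ler_sum => i _.
rewrite ler_sqr ?nnegrE // normrM norm_of_real ?weighted_filter_ge0 //.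
by rewrite ler_piMl // -(of_real1 R k) of_real_le weighted_filter_le1.
Qed.

End OperatorTheory.

Lemma phase (F : numFieldType) (a : F) : exists2 c, `|c| = 1 & a = `|a| * c.
Proof.
have [->|a0] := eqVneq a 0; first by exists 1; rewrite ?normr1 // normr0 mul0r.
exists (a / `|a|); first by rewrite normrM normfV normr_id divff ?normr_eq0.
by rewrite mulrC divfK ?normr_eq0.
Qed.

(** * Lower bounds on the worst-case error *)

Section Bounds.
Variables (R : realType) (k : scalar_kind).
Variables (X Y : completeNormedModType (scalar R k)).
Variables (dX : inner_product X) (dY : inner_product Y) (K : {linear X -> Y}).
Variables (sigma : nat -> R) (v : nat -> X) (u : nat -> Y).
Hypothesis sveK : singular_value_expansion dX dY K sigma v u.

(** The noise level is chosen so that the noise [delta *: c *: u m] is the image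
    of [(s * c) *: v m].  Since the datum lies in the range of [K], everything
    can be computed on the side of [X]. *)
Lemma worst_case_error_lower_bounds (r : R) (xdag : X) (m : nat)
    (alpha : R -> Y -> R) (E : R) :
  let s := sigma m `^ (r + 1) in
  let delta := sigma m * s in
  (forall yd, 0 < alpha delta yd) ->
  (worst_case_error dY K sigma v u r alpha (K xdag) xdag delta <= E%:E)%E ->
  exists2 a, 0 < a &
    s / (s + a) * s <= E /\
    forall j, (j < m)%N ->
      a / (sigma j `^ (r + 1) + a) * re_part `|dX xdag (v j)| <= E.
Proof.
move=> s delta a0 errE.
have sgt0 := sve_gt0 sveK.
have s0 i : 0 < sigma i `^ (r + 1) by rewrite powR_gt0.
(* With this phase the two error terms in the direction [v m] add up. *)
have [c c1 xmE] := phase (dX xdag (v m)).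
pose h : X := (of_real k s * c) *: v m.
pose z := xdag - h.
pose a := alpha delta (K z).
exists a; first exact: a0.
pose x' := weighted_tikhonov dY sigma v u a r (K z).
have coef_le j : `|dX x' (v j) - dX xdag (v j)| <= of_real k E.
  rewrite -innerBl; apply: le_trans (norm_coef_le (sve_orthonormalv sveK) _ _) _.
  rewrite -rnormK of_real_le -lee_fin; apply: le_trans errE.
  apply: ereal_sup_ubound; exists (K z) => //=.
  rewrite -linearB /= /z opprB addrC subrK orthoproj_id; last first.
    by apply: subset_closure; exists h.
  rewrite /h linearZ /= (sve_K sveK) scalerA -(of_real_le k) rnormK normrZ.
  rewrite (norm_unit (dX := dY)) ?(sve_orthonormalu sveK) ?eqxx //.
  by rewrite mulr1 !normrM c1 mulr1 !norm_of_real ?(ltW (s0 _)) ?(ltW (sgt0 _)) //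
    mulrC -of_realM.
split=> [|j jm].
  rewrite -(of_real_le k); apply: le_trans (coef_le m).
  rewrite inner_weighted_tikhonov ?a0 // /z innerBl innerZl.
  rewrite (sve_orthonormalv sveK) eqxx mulr1.
  set F := weighted_filter _ _ _.
  have F0 : 0 <= F by apply: weighted_filter_ge0; exact: a0.
  have F1 : F <= 1 by apply: weighted_filter_le1; exact: a0.
  set t := `|dX xdag (v m)| in xmE *.
  have t0 : 0 <= t by exact: normr_ge0.
  have -> : of_real k F * (dX xdag (v m) - of_real k s * c) - dX xdag (v m) =
      - ((of_real k (1 - F) * t + of_real k (F * s)) * c).
    by rewrite xmE of_realD of_realN of_real1 of_realM; ring.
  rewrite normrN normrM c1 mulr1 ger0_norm.
    by rewrite lerDr mulr_ge0 ?of_real_ge0 ?subr_ge0.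
  apply: addr_ge0; first by rewrite mulr_ge0 // of_real_ge0 // subr_ge0.
  by apply/of_real_ge0/mulr_ge0; last exact: ltW (s0 m).
rewrite -(of_real_le k); apply: le_trans (coef_le j).
rewrite inner_weighted_tikhonov ?a0 // /z innerBl innerZl.
rewrite (sve_orthonormalv sveK) gtn_eqF // mulr0 subr0.
have sa0 : 0 < sigma j `^ (r + 1) + a by rewrite addr_gt0 // a0.
have -> : a / (sigma j `^ (r + 1) + a) = 1 - weighted_filter a r (sigma j).
  have sa0' := lt0r_neq0 sa0; apply: (mulIf sa0').
  by rewrite mulrBl !divfK // mul1r addrAC subrr add0r.
set F := weighted_filter _ _ _.
have F1 : F <= 1 by apply: weighted_filter_le1; exact: a0.
have -> : of_real k F * dX xdag (v j) - dX xdag (v j) =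
    - (of_real k (1 - F) * dX xdag (v j)).
  by rewrite of_realD of_realN of_real1; ring.
by rewrite normrN normrM of_realM re_partK // norm_of_real // subr_ge0.
Qed.

End Bounds.

Theorem proposition13 (R : realType) (k : scalar_kind)
    (X Y : completeNormedModType (scalar R k))
    (dX : inner_product X) (dY : inner_product Y)
    (K : {linear X -> Y})
    (K_compact : compact_operator K)
    (K_range : infinite_dim_range K)
    (sigma : nat -> R) (v : nat -> X) (u : nat -> Y)
    (sveK : singular_value_expansion dX dY K sigma v u)
    (r : R) (r_ge0 : 0 <= r)
    (y : Y) (y_attainable : range K y)
    (alpha : R -> Y -> R)
    (alpha_gt0 : forall delta yd, 0 < delta -> 0 < alpha delta yd) :
  let xdag := moore_penrose dX dY K y in
  let err := worst_case_error dY K sigma v u r alpha y xdag in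
  (\forall delta \near 0^'+, err delta \is a fin_num) ->
  (fun delta : R => fine (err delta) : R^o) =o_ (0^'+)
    (fun delta : R => delta `^ ((r + 1) / (r + 2)) : R^o) ->
  xdag = 0.
Proof.
move=> xdag err err_fin /eqoP err_o.
apply: contrapT => xdagN0.
have [xdag_perp Kxdag] := moore_penroseP y_attainable xdagN0.
apply: xdagN0; apply: (complete_eq0 (dX := dX) (sve_completev sveK) xdag_perp) => j.
have sgt0 := sve_gt0 sveK.
pose t := re_part `|dX xdag (v j)|.
have tE : of_real k t = `|dX xdag (v j)| by rewrite re_partK.
have t0 : 0 <= t by rewrite -(of_real_le k) tE of_real0.
have s0 i : 0 < sigma i `^ (r + 1) by rewrite powR_gt0.
suff small eps : 0 < eps -> eps <= 1 / 2 -> t <= 2 * eps * sigma j `^ (r + 1).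
  suff t00 : t = 0 by move/esym/eqP: tE; rewrite t00 of_real0 normr_eq0 => /eqP.
  apply/eqP; rewrite eq_le t0 andbT leNgt; apply/negP => tgt0.
  set s := sigma j `^ (r + 1) in small.
  have sj0 : 0 < s by exact: s0.
  pose e := Num.min (1 / 2) (t / (4 * s)).
  have e0 : 0 < e by rewrite lt_min divr_gt0 //= divr_gt0 // mulr_gt0.
  have := small _ e0; rewrite ge_min lexx => /(_ isT) te.
  have : e * (4 * s) <= t by rewrite -ler_pdivlMr ?mulr_gt0 // ge_min lexx orbT.
  by lra.
move=> eps0 eps1.
have [eta /= eta0 near0] : \forall delta \near (0 : R)^'+,
    err delta \is a fin_num /\
    fine (err delta) <= eps * delta `^ ((r + 1) / (r + 2)).
  near=> delta; split; first by near: delta.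
  have : `|fine (err delta) : R^o| <= eps * `|delta `^ ((r + 1) / (r + 2)) : R^o|.
    near: delta; exact: err_o.
  move=> /(le_trans (ler_norm _)) /le_trans; apply.
  by rewrite ger0_norm // powR_ge0.
(* Below 1, [sigma m < eta] already implies [delta < eta]. *)
have [|N sN] := sigma_lt (e := Num.min 1 eta) sveK K_compact.
  by rewrite lt_min ltr01.
pose m := maxn N j.+1.
have := sN m (leq_maxl _ _); rewrite lt_min => /andP[sm1 smeta].
set s := sigma m `^ (r + 1).
have s1 : s <= 1.
  have := @ge0_ler_powR _ (r + 1) ltac:(by rewrite addr_ge0) (sigma m) 1.
  by rewrite powR1; apply; rewrite ?nnegrE // ltW.
pose delta := sigma m * s.
have delta0 : 0 < delta by rewrite mulr_gt0 // s0.
have deltaE : delta `^ ((r + 1) / (r + 2)) = s.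
  have r2 : r + 2 != 0 by rewrite gt_eqF // ltr_wpDl.
  have -> : delta = sigma m `^ (r + 2).
    rewrite /delta /s -{1}[sigma m]powRr1 ?ltW // -powRD.
      by congr (_ `^ _); ring.
    by rewrite (gt_eqF (sgt0 m)) implybT.
  by rewrite -powRrM mulrC divfK.
have [] := near0 delta.
- rewrite /ball_ /= sub0r normrN ger0_norm ?ltW //.
  by apply: le_lt_trans smeta; rewrite ler_piMr // ltW.
- exact: delta0.
rewrite deltaE => fin_err err_le.
have [||a a0 [hm hj]] := worst_case_error_lower_bounds sveK
  (r := r) (xdag := xdag) (m := m) (alpha := alpha) (E := eps * s).
- by move=> yd; exact: alpha_gt0.
- by rewrite Kxdag -/err -/delta -(fineK fin_err) lee_fin.
apply: (filter_tradeoff _ _ a0 eps0 eps1 t0 hm (hj j _)).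
- exact: s0.
- apply: ge0_ler_powR; rewrite ?nnegrE ?addr_ge0 ?(ltW (sgt0 _)) //.
  by apply: (le_sigma sveK); rewrite ltnW // leq_maxr.
- by rewrite leq_maxr.
Unshelve. all: by end_near.
Qed.
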